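(* Let $M=-m^{2}$ with $m>0$, and set $$g(M)=-\frac{m^{2}\cosh\left(\frac m2\right)}{\cosh\left(\frac m2\right)-1},\qquad k(M)=-m^2\coth^2\left(\tfrac m2\right).$$ Let $\delta_2\in(g(M),M)$ and $\delta_1\in\mathbb{R}$. Then: 1. If $\delta_2\in(g(M),k(M)]$, then $G_{M,\delta_1,\delta_2}$ is strictly positive on $[0,1]\times[0,1]$ if and only if $$|\delta_1|<\frac{\sqrt{\delta_2^{2}-\left(m^{2}+\delta_2\right)^{2}\cosh^{2}\left(\frac m2\right)}}{m}.$$ 2. If $\delta_2\in(k(M),M)$, then $G_{M,\delta_1,\delta_2}$ is strictly positive on $[0,1]\times[0,1]$ if and only if $|\delta_1|<m\coth\left(\frac m2\right)$.
   Context: Let $I=[0,1]$. For real parameters $M,\delta_1,\delta_2$ consider the problem $$u''(t)+M\,u(t)=\sigma(t),\ t\in I,\qquad u(0)-u(1)=\delta_1\int_0^1u(s)\,ds,\qquad u'(0)-u'(1)=\delta_2\int_0^1u(s)\,ds,$$ with $\sigma\in C(I)$. If this problem has a unique solution $u\in C^2(I)$ for every $\sigma\in C(I)$ (this happens exactly when $\delta_2\ne M$ and $M\neq 4k^2\pi^2$ for all integers $k\ge 1$), its Green's function $G_{M,\delta_1,\delta_2}$ is the unique continuous function on $I\times I$ such that for every $\sigma\in C(I)$ the unique solution is $u(t)=\int_0^1G_{M,\delta_1,\delta_2}(t,s)\,\sigma(s)\,ds$. For $M<0$ one has $g(M)<k(M)<M$. *)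

(* Defs.v *)
From Stdlib Require Import Reals.
From Coquelicot Require Import Coquelicot.
Open Scope R_scope.

Definition coth (x : R) : R := cosh x / sinh x.

Definition unit_interval (t : R) : Prop := 0 <= t <= 1.

Definition unit_square (p : R * R) : Prop :=
  unit_interval (fst p) /\ unit_interval (snd p).

(* Functions on [0,1] are represented by functions on R whose values outside
   [0,1] are irrelevant: derivatives and continuity are taken within [0,1],
   hence one-sidedly at the endpoints.  [du] and [ddu] are u' and u''; the
   continuity of [ddu] is what makes u of class C^2 on [0,1]. *)
Definition is_solution (M delta1 delta2 : R) (sigma u : R -> R) : Prop :=
  exists du ddu : R -> R,
    (forall t, unit_interval t -> D_in u du unit_interval t) /\
    (forall t, unit_interval t -> D_in du ddu unit_interval t) /\
    continuous_on unit_interval ddu /\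
    (forall t, unit_interval t -> ddu t + M * u t = sigma t) /\
    u 0 - u 1 = delta1 * RInt u 0 1 /\
    du 0 - du 1 = delta2 * RInt u 0 1.

(* For each continuous right-hand side the problem has exactly one solution
   (up to equality on [0,1]), given by integration against [G].  These
   conditions determine the values of [G] on [0,1] x [0,1]. *)
Definition is_green_function (M delta1 delta2 : R) (G : R -> R -> R) : Prop :=
  continuous_on unit_square (fun p => G (fst p) (snd p)) /\
  forall sigma : R -> R, continuous_on unit_interval sigma ->
    let u := fun t => RInt (fun s => G t s * sigma s) 0 1 in
    is_solution M delta1 delta2 sigma u /\
    (forall v, is_solution M delta1 delta2 sigma v ->
       forall t, unit_interval t -> v t = u t).

Definition strictly_positive (G : R -> R -> R) : Prop :=
  forall t s, unit_interval t -> unit_interval s -> 0 < G t s.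

(* Main.v *)
Require Import Defs.
From Stdlib Require Import Reals Lra.
From Coquelicot Require Import Coquelicot.
Open Scope R_scope.

(** The Green function can be written down, and its positivity is then a
    question about one hyperbolic expression.

    Write [p = - delta2], [q = delta1 * m], [h = m / 2] and let [I] be the
    integral of a solution [u] over [[0,1]].  Integrating [cosh (a + b s)]
    with [b = m] or [b = - m] against [u'' - m^2 u] gives only boundary terms
    ([is_RInt_cosh_operator]); doing this on [[0,t]] and on [[t,1]] with
    [cosh (m (1/2 - |t - s|))] leaves [u t] and the two jumps
    [u 0 - u 1 = delta1 I] and [u' 0 - u' 1 = delta2 I].  Integrating the
    equation itself expresses [I] through the integral of [sigma].  Eliminating
    [I] yields [u t] as the integral of [green t s * sigma s]
    ([green_representation]).  Since [G] gives the same solutions, testing with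
    [sigma = G t - green t] makes the integral of a square vanish, so [G] and
    [green] agree on the square ([green_unique]).

    For fixed [t] the kernel is smallest on the diagonal [s = t], because
    [cosh (m (1/2 - r))] is largest at [r = 0].  With [x = m (t - 1/2)],
    positivity therefore means
    [(p - m^2) cosh h < p cosh x - q sinh x] whenever [|x| <= h]
    ([green_pos_iff]).  For [|q| < p] the right side has minimum
    [sqrt (p^2 - q^2)] over the real line, attained where [tanh x = q / p].  At
    [x = h] or [x = - h] the condition reads [|q| sinh h < m^2 cosh h].  If
    [p >= m^2 coth^2 h], that endpoint condition already forces
    [|q| / p < tanh h], so the minimum lies inside the interval and the square
    root gives the criterion ([hyperbolic_interior_iff]).  If
    [p < m^2 coth^2 h], the endpoint condition is sufficient by itself
    ([hyperbolic_endpoint_iff]); the lower bound [g(M)] on [delta2] is the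
    condition at [x = 0], where [q] drops out. *)

(** * Calculus on the closed unit interval *)

(** Retraction of the line onto the unit interval, written with absolute values
    so that its continuity is immediate. *)
Definition clamp (x : R) : R := (Rabs x - Rabs (x - 1) + 1) / 2.

Lemma clamp_id x : unit_interval x -> clamp x = x.
Proof.
  unfold unit_interval, clamp; intros Hx.
  rewrite (Rabs_right x), (Rabs_left1 (x - 1)) by lra; field.
Qed.

Lemma clamp_unit x : unit_interval (clamp x).
Proof.
  unfold unit_interval, clamp.
  unfold Rabs; destruct (Rcase_abs x), (Rcase_abs (x - 1)); lra.
Qed.

Lemma continuous_clamp x : continuous clamp x.
Proof.
  unfold clamp, Rdiv.
  apply (continuous_mult (K := R_AbsRing)); [|apply continuous_const].
  apply (continuous_plus (V := R_NormedModule)); [|apply continuous_const].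
  apply (continuous_minus (V := R_NormedModule)).
  - apply continuous_Rabs.
  - apply (continuous_comp (fun y => y - 1) Rabs); [|apply continuous_Rabs].
    apply (continuous_minus (V := R_NormedModule));
      [apply continuous_id|apply continuous_const].
Qed.

Lemma locally_open_unit x : 0 < x < 1 -> locally x (fun y => 0 < y < 1).
Proof.
  intros Hx.
  apply (open_and (fun y => 0 < y) (fun y => y < 1)); [apply open_gt|apply open_lt|exact Hx].
Qed.

(** Continuity on the unit interval in a form to which two-sided continuity
    and integration results apply: the extension of [f] by its endpoint values
    is continuous on the whole line. *)
Definition continuous_unit (f : R -> R) : Prop :=
  forall x, continuous (fun y => f (clamp y)) x.

Lemma continuous_clamp_of_on f : continuous_on unit_interval f -> continuous_unit f.
Proof.
  intros Hf x P HP.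
  generalize (Hf (clamp x) (clamp_unit x) P HP); intros HW.
  generalize (continuous_clamp x _ HW); unfold filtermap.
  apply filter_imp; intros y Hy; apply Hy, clamp_unit.
Qed.

Lemma continuous_on_of_clamp f : continuous_unit f -> continuous_on unit_interval f.
Proof.
  intros Hf x Hx P HP.
  assert (HP' : locally (f (clamp x)) P) by now rewrite clamp_id.
  generalize (Hf x P HP'); unfold filtermap, within.
  apply filter_imp; intros y Hy Iy; now rewrite clamp_id in Hy.
Qed.

Lemma continuous_unit_of_continuous f : (forall x, continuous f x) -> continuous_unit f.
Proof.
  intros Hf x; apply (continuous_comp clamp f); [apply continuous_clamp|apply Hf].
Qed.

Lemma continuous_unit_mult f g :
  continuous_unit f -> continuous_unit g ->
  continuous_unit (fun x => f x * g x).
Proof. intros Hf Hg x; apply (continuous_mult (K := R_AbsRing)); auto. Qed.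

Lemma continuous_unit_minus f g :
  continuous_unit f -> continuous_unit g ->
  continuous_unit (fun x => f x - g x).
Proof. intros Hf Hg x; apply (continuous_minus (V := R_NormedModule)); auto. Qed.

Lemma ex_RInt_clamp f a b : continuous_unit f -> ex_RInt (fun y => f (clamp y)) a b.
Proof.
  intros Hf; apply (ex_RInt_continuous (V := R_CompleteNormedModule)); intros; apply Hf.
Qed.

Lemma is_derive_RInt_clamp f a x :
  continuous_unit f ->
  is_derive (fun z => RInt (fun y => f (clamp y)) a z) x (f (clamp x)).
Proof.
  intros Hf; apply (is_derive_RInt (fun y => f (clamp y)) _ a); [|apply Hf].
  apply filter_forall; intros y.
  apply (RInt_correct (V := R_CompleteNormedModule)), ex_RInt_clamp, Hf.
Qed.

Lemma ex_RInt_unit f a b :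
  0 <= a <= b -> b <= 1 -> continuous_unit f -> ex_RInt f a b.
Proof.
  intros Hab Hb Hf.
  apply (ex_RInt_ext (fun y => f (clamp y))).
  - rewrite Rmin_left, Rmax_right by lra; intros x Hx.
    rewrite clamp_id; [reflexivity|unfold unit_interval; lra].
  - now apply ex_RInt_clamp.
Qed.

(** The derivative is only assumed at interior points, which is all that
    one-sided derivatives at 0 and 1 provide.  The difference of [F] and the
    integral function of the extended [f] is continuous on [[a,b]] with zero
    derivative inside, so the mean value theorem makes it constant. *)
Lemma is_RInt_antiderivative F f a b :
  0 <= a <= b -> b <= 1 -> continuous_unit F -> continuous_unit f ->
  (forall x, 0 < x < 1 -> is_derive F x (f x)) ->
  is_RInt f a b (F b - F a).
Proof.
  intros Hab Hb HF Hf HD.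
  set (Phi := fun x => RInt (fun y => f (clamp y)) a x).
  assert (HPhi : forall x, is_derive Phi x (f (clamp x)))
    by (intros x; apply (is_derive_RInt_clamp f a x Hf)).
  destruct (MVT_gen (fun x => F (clamp x) - Phi x) a b (fun _ => 0)) as [c [_ Hc]].
  - rewrite Rmin_left, Rmax_right by lra; intros x Hx.
    replace 0 with (f x - f (clamp x))
      by (rewrite clamp_id; [ring|unfold unit_interval; lra]).
    apply (is_derive_minus (V := R_NormedModule)); [|apply HPhi].
    apply (is_derive_ext_loc F); [|apply HD; lra].
    generalize (locally_open_unit x ltac:(lra)).
    apply filter_imp; intros y Hy.
    rewrite clamp_id; [reflexivity|unfold unit_interval; lra].
  - intros x _; apply continuity_pt_filterlim.
    apply (continuous_minus (V := R_NormedModule) (fun y => F (clamp y)) Phi); [apply HF|].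
    apply (ex_derive_continuous (V := R_NormedModule) Phi x).
    exists (f (clamp x)); apply HPhi.
  - assert (H0 : Phi a = 0) by apply (RInt_point (V := R_CompleteNormedModule)).
    rewrite !clamp_id, H0 in Hc by (unfold unit_interval; lra).
    replace (F b - F a) with (Phi b) by lra.
    apply (is_RInt_ext (fun y => f (clamp y))).
    + rewrite Rmin_left, Rmax_right by lra; intros x Hx.
      rewrite clamp_id; [reflexivity|unfold unit_interval; lra].
    + apply (RInt_correct (V := R_CompleteNormedModule)), ex_RInt_clamp, Hf.
Qed.

(** The integral function from 0 is squeezed to zero on the open interval, so
    its derivative [f] vanishes there; continuity reaches the endpoints. *)
Lemma RInt_nonneg_eq0 f :
  continuous_unit f -> (forall x, unit_interval x -> 0 <= f x) -> RInt f 0 1 = 0 ->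
  forall x, unit_interval x -> f x = 0.
Proof.
  intros Hf Hpos H0.
  set (g := fun y => f (clamp y)).
  assert (HI : forall x y, ex_RInt g x y).
  { intros; now apply ex_RInt_clamp. }
  set (P := fun x => RInt g 0 x).
  assert (HP : forall x, 0 < x < 1 -> P x = 0).
  { intros x Hx.
    assert (Hg0 : RInt g 0 1 = 0).
    { transitivity (RInt f 0 1); [|exact H0]; apply RInt_ext.
      rewrite Rmin_left, Rmax_right by lra; intros y Hy; unfold g.
      rewrite clamp_id; [reflexivity|unfold unit_interval; lra]. }
    generalize (RInt_Chasles (V := R_CompleteNormedModule) g 0 x 1 (HI _ _) (HI _ _)).
    change (plus (RInt g 0 x) (RInt g x 1)) with (RInt g 0 x + RInt g x 1).
    rewrite Hg0; intros HC.
    assert (H1 : 0 <= RInt g 0 x).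
    { apply RInt_ge_0; [lra|apply HI|intros; apply Hpos, clamp_unit]. }
    assert (H2 : 0 <= RInt g x 1).
    { apply RInt_ge_0; [lra|apply HI|intros; apply Hpos, clamp_unit]. }
    unfold P; lra. }
  assert (Hin : forall x, 0 < x < 1 -> f x = 0).
  { intros x Hx.
    assert (D1 : is_derive P x (g x)).
    { apply (is_derive_RInt_clamp f 0 x Hf). }
    assert (D2 : is_derive P x 0).
    { apply (is_derive_ext_loc (fun _ => 0)); [|apply (is_derive_const (V := R_NormedModule))].
      generalize (locally_open_unit x Hx).
      apply filter_imp; intros y Hy; symmetry; now apply HP. }
    apply is_derive_unique in D1, D2; rewrite D2 in D1; unfold g in D1.
    rewrite clamp_id in D1; [easy|unfold unit_interval; lra]. }
  intros x Hx.
  destruct (Req_dec (f x) 0) as [|Hn]; [assumption|exfalso].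
  assert (Hloc : locally (g x) (fun y => y <> 0)).
  { assert (Ha : 0 < Rabs (g x)).
    { apply Rabs_pos_lt; unfold g; now rewrite clamp_id. }
    exists (mkposreal _ Ha); intros y Hy Hy0.
    change (Rabs (y - g x) < Rabs (g x)) in Hy.
    rewrite Hy0, Rminus_0_l, Rabs_Ropp in Hy; lra. }
  destruct (Hf x _ Hloc) as [d Hd].
  (* Moving [x] towards the midpoint by a small proportion [e] stays within [d]
     of [x] and lands in the open interval, even when [x] is 0 or 1. *)
  set (e := Rmin 1 d).
  assert (He : 0 < e) by (apply Rmin_glb_lt; [lra|apply cond_pos]).
  assert (He1 : e <= 1) by apply Rmin_l.
  assert (Hed : e <= d) by apply Rmin_r.
  unfold unit_interval in Hx.
  assert (Hy : 0 < x + (1/2 - x) * e < 1) by nra.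
  apply (Hd (x + (1/2 - x) * e)).
  - change (Rabs (x + (1/2 - x) * e - x) < d).
    apply Rabs_def1; nra.
  - rewrite clamp_id by (unfold unit_interval; lra); now apply Hin.
Qed.

Lemma D_in_continuous_on f df :
  (forall t, unit_interval t -> D_in f df unit_interval t) ->
  continuous_on unit_interval f.
Proof.
  intros Hf x Hx.
  generalize (cont_deriv f df unit_interval x (Hf x Hx)).
  unfold continue_in, limit1_in, limit_in; intros HL.
  apply filterlim_locally; intros eps.
  destruct (HL eps (cond_pos eps)) as [al [Hal HH]].
  exists (mkposreal al Hal); intros y Hy Iy.
  destruct (Req_dec x y) as [<-|Hn]; [apply ball_center|].
  apply (HH y); split; [split; [assumption|congruence]|exact Hy].
Qed.

Lemma D_in_is_derive f df x :
  0 < x < 1 -> D_in f df unit_interval x -> is_derive f x (df x).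
Proof.
  intros Hx HD; apply is_derive_Reals; intros eps Heps.
  destruct (HD eps Heps) as [al [Hal HH]].
  assert (Hr : 0 < Rmin al (Rmin x (1 - x))) by (repeat apply Rmin_glb_lt; lra).
  exists (mkposreal _ Hr); intros h Hh0 Hh; simpl in Hh.
  generalize (Rmin_l al (Rmin x (1 - x))) (Rmin_r al (Rmin x (1 - x)))
    (Rmin_l x (1 - x)) (Rmin_r x (1 - x)); intros H1 H2 H3 H4.
  generalize (Rabs_def2 _ _ Hh); intros Hh'.
  assert (Hs : x + h - x = h) by ring.
  generalize (HH (x + h)); simpl; unfold Rdist; rewrite Hs; intros HH'.
  apply HH'; split; [split; [unfold unit_interval; lra|lra]|lra].
Qed.

(** * The explicit Green function *)

Lemma continuous_cosh_affine a b x : continuous (fun s => cosh (a + b * s)) x.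
Proof.
  apply (ex_derive_continuous (V := R_NormedModule)); unfold cosh; auto_derive; auto.
Qed.

Lemma continuous_sinh_affine a b x : continuous (fun s => sinh (a + b * s)) x.
Proof.
  apply (ex_derive_continuous (V := R_NormedModule)); unfold sinh; auto_derive; auto.
Qed.

(** [cosh (a + b s)] is annihilated by the operator [u'' - b^2 u], which is
    formally self-adjoint, so by Lagrange's identity the integrand is an exact
    derivative. *)
Lemma is_RInt_cosh_operator a b u du ddu p q :
  (forall t, unit_interval t -> D_in u du unit_interval t) ->
  (forall t, unit_interval t -> D_in du ddu unit_interval t) ->
  continuous_on unit_interval ddu ->
  0 <= p <= q -> q <= 1 ->
  is_RInt (fun s => cosh (a + b * s) * (ddu s - b ^ 2 * u s)) p q
    ((cosh (a + b * q) * du q - b * sinh (a + b * q) * u q)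
     - (cosh (a + b * p) * du p - b * sinh (a + b * p) * u p)).
Proof.
  intros Hu Hdu Hc Hpq Hq.
  assert (Cu := continuous_clamp_of_on _ (D_in_continuous_on _ _ Hu)).
  assert (Cdu := continuous_clamp_of_on _ (D_in_continuous_on _ _ Hdu)).
  assert (Cddu := continuous_clamp_of_on _ Hc).
  assert (Ccosh := continuous_unit_of_continuous _ (continuous_cosh_affine a b)).
  assert (Csinh := continuous_unit_of_continuous _ (continuous_sinh_affine a b)).
  assert (Cst : forall c, continuous_unit (fun _ => c))
    by (intros c; apply continuous_unit_of_continuous; intros; apply continuous_const).
  apply (is_RInt_antiderivative
    (fun s => cosh (a + b * s) * du s - b * sinh (a + b * s) * u s)); auto.
  - repeat first [assumption | apply Cst
                 | apply continuous_unit_minus | apply continuous_unit_mult].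
  - repeat first [assumption | apply Cst
                 | apply continuous_unit_minus | apply continuous_unit_mult].
  - intros x Hx.
    assert (Ix : unit_interval x) by (unfold unit_interval; lra).
    assert (D1 := D_in_is_derive _ _ _ Hx (Hu x Ix)).
    assert (D2 := D_in_is_derive _ _ _ Hx (Hdu x Ix)).
    unfold cosh, sinh; auto_derive.
    + repeat split; auto; eexists; eassumption.
    + rewrite (is_derive_unique _ _ _ D1 : Derive (fun x => u x) x = _),
        (is_derive_unique _ _ _ D2 : Derive (fun x => du x) x = _); field.
Qed.

(** The [cosh] of the distance is the kernel of the periodic problem
    ([delta1 = delta2 = 0]); the fraction over [m ^ 2 + delta2] is the
    homogeneous solution whose jumps correct it for the integral conditions. *)
Definition green (m delta1 delta2 t s : R) : R :=
  ((delta2 * cosh (m * (t - 1 / 2)) + delta1 * m * sinh (m * (t - 1 / 2)))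
     / (m ^ 2 + delta2)
   - cosh (m * (1 / 2 - Rabs (t - s)))) / (2 * m * sinh (m / 2)).

Lemma sinh_pos x : 0 < x -> 0 < sinh x.
Proof. intros Hx; rewrite <- sinh_0; now apply sinh_lt. Qed.

Lemma cosh_opp x : cosh (- x) = cosh x.
Proof. unfold cosh; rewrite Ropp_involutive; field. Qed.

Lemma sinh_opp x : sinh (- x) = - sinh x.
Proof. unfold sinh; rewrite Ropp_involutive; field. Qed.

(** Starting from a given solution, its boundary terms can be read off from the
    fundamental theorem of calculus; checking instead that the integral of the
    kernel solves the problem would require differentiating it twice. *)
Lemma green_representation m delta1 delta2 sigma u t :
  0 < m -> m ^ 2 + delta2 <> 0 ->
  is_solution (- m ^ 2) delta1 delta2 sigma u -> unit_interval t ->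
  is_RInt (fun s => green m delta1 delta2 t s * sigma s) 0 1 (u t).
Proof.
  intros Hm Hd (du & ddu & Hu & Hdu & Hc & Heq & B1 & B2) Ht.
  assert (HS := sinh_pos (m / 2) ltac:(lra)).
  set (I := RInt u 0 1) in *.
  assert (HI : is_RInt u 0 1 I).
  { apply (RInt_correct (V := R_CompleteNormedModule)), ex_RInt_unit; [lra|lra|].
    now apply continuous_clamp_of_on, (D_in_continuous_on u du). }
  assert (Hsig : is_RInt sigma 0 1 (du 1 - du 0 - m ^ 2 * I)).
  { apply (is_RInt_ext (fun s => minus (ddu s) (scal (m ^ 2) (u s)))).
    - rewrite Rmin_left, Rmax_right by lra; intros s Hs.
      rewrite <- Heq by (unfold unit_interval; lra).
      unfold minus, plus, opp, scal; simpl; unfold mult; simpl; ring.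
    - apply (is_RInt_minus (V := R_NormedModule)).
      + apply is_RInt_antiderivative; try lra; try apply continuous_clamp_of_on; auto.
        * now apply (D_in_continuous_on du ddu).
        * intros x Hx; apply D_in_is_derive; [exact Hx|].
          apply Hdu; unfold unit_interval; lra.
      + now apply (is_RInt_scal (V := R_NormedModule)). }
  (* The [du t] terms of the two halves cancel at the kink [s = t] while the
     [u t] terms add up; the ends 0 and 1 produce the two prescribed jumps. *)
  assert (Hcosh : is_RInt (fun s => cosh (m * (1 / 2 - Rabs (t - s))) * sigma s) 0 1
    (- (2 * m * sinh (m / 2)) * u t
     - cosh (m * (t - 1 / 2)) * (delta2 * I)
     - m * sinh (m * (t - 1 / 2)) * (delta1 * I))).
  { unfold unit_interval in Ht.
    assert (HL := is_RInt_cosh_operator (m * (1 / 2 - t)) m u du ddu 0 t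
      Hu Hdu Hc ltac:(lra) ltac:(lra)).
    assert (HR := is_RInt_cosh_operator (m * (1 / 2 + t)) (- m) u du ddu t 1
      Hu Hdu Hc ltac:(lra) ltac:(lra)).
    evar_last.
    - apply (is_RInt_Chasles (V := R_NormedModule) _ 0 t 1).
      + eapply is_RInt_ext; [|exact HL].
        rewrite Rmin_left, Rmax_right by lra; intros s Hs; simpl.
        rewrite Rabs_right, <- Heq by (unfold unit_interval; lra).
        f_equal; [f_equal|]; ring.
      + eapply is_RInt_ext; [|exact HR].
        rewrite Rmin_left, Rmax_right by lra; intros s Hs; simpl.
        rewrite Rabs_left, <- Heq by (unfold unit_interval; lra).
        f_equal; [f_equal|]; ring.
    - unfold plus; simpl.
      replace (m * (1 / 2 - t) + m * t) with (m / 2) by field.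
      replace (m * (1 / 2 - t) + m * 0) with (- (m * (t - 1 / 2))) by field.
      replace (m * (1 / 2 + t) + - m * t) with (m / 2) by field.
      replace (m * (1 / 2 + t) + - m * 1) with (m * (t - 1 / 2)) by field.
      rewrite cosh_opp, sinh_opp, <- B1, <- B2; ring. }
  set (c := (delta2 * cosh (m * (t - 1 / 2)) + delta1 * m * sinh (m * (t - 1 / 2)))
    / (m ^ 2 + delta2)).
  assert (H := is_RInt_scal (V := R_NormedModule) _ _ _ (/ (2 * m * sinh (m / 2))) _
    (is_RInt_minus (V := R_NormedModule) _ _ _ _ _ _
      (is_RInt_scal (V := R_NormedModule) _ _ _ c _ Hsig) Hcosh)).
  evar_last.
  - eapply is_RInt_ext; [|exact H].
    intros s _; unfold green; fold c.
    unfold minus, plus, opp, scal; simpl; unfold mult; simpl.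
    field; lra.
  - unfold c, minus, plus, opp, scal; simpl; unfold mult; simpl.
    replace (du 1) with (du 0 - delta2 * I) by lra.
    field; simpl in Hd; lra.
Qed.

Lemma green_continuous_r m delta1 delta2 t : continuous_unit (green m delta1 delta2 t).
Proof.
  apply continuous_unit_of_continuous; intros s.
  unfold green, Rdiv at 1.
  apply (continuous_mult (K := R_AbsRing)); [|apply continuous_const].
  apply (continuous_minus (V := R_NormedModule)); [apply continuous_const|].
  apply (continuous_comp (fun s => Rabs (t - s)) (fun r => cosh (m * (1 / 2 - r)))).
  - apply (continuous_Rabs_comp (fun s => t - s)).
    apply (continuous_minus (V := R_NormedModule));
      [apply continuous_const|apply continuous_id].
  - apply (continuous_ext (fun r => cosh (m * (1 / 2) + - m * r))).
    + intros r; f_equal; ring.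
    + apply continuous_cosh_affine.
Qed.

(** For fixed [t], take as right-hand side the difference [d] of the two
    kernels: both integrals represent the same solution at [t], so [d] has zero
    square integral. *)
Lemma green_unique m delta1 delta2 G t s :
  0 < m -> m ^ 2 + delta2 <> 0 ->
  is_green_function (- m ^ 2) delta1 delta2 G ->
  unit_interval t -> unit_interval s -> G t s = green m delta1 delta2 t s.
Proof.
  intros Hm Hd [HGc HG] Ht Hs.
  set (d := fun r => G t r - green m delta1 delta2 t r).
  assert (CG : continuous_unit (G t)).
  { apply continuous_clamp_of_on; intros r Hr.
    intros P HP.
    destruct (HGc (t, r) (conj Ht Hr) P HP) as [e He].
    exists e; intros r' Hr' Ir'.
    apply (He (t, r')); [|split; assumption].
    split; [apply ball_center|exact Hr']. }
  assert (Cd : continuous_unit d)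
    by (apply continuous_unit_minus; [exact CG|apply green_continuous_r]).
  destruct (HG d (continuous_on_of_clamp _ Cd)) as [Hsol _].
  assert (HR := green_representation _ _ _ _ _ _ Hm Hd Hsol Ht).
  assert (HI : is_RInt (fun r => G t r * d r) 0 1 (RInt (fun r => G t r * d r) 0 1)).
  { apply (RInt_correct (V := R_CompleteNormedModule)), ex_RInt_unit; [lra|lra|].
    now apply continuous_unit_mult. }
  assert (Hdd : is_RInt (fun r => d r * d r) 0 1 0).
  { evar_last.
    - eapply is_RInt_ext; [|exact (is_RInt_minus (V := R_NormedModule) _ _ _ _ _ _ HI HR)].
      intros r _; unfold minus, plus, opp; simpl; unfold d; ring.
    - unfold minus; apply (plus_opp_r (G := R_AbelianGroup)). }
  assert (H0 : d s * d s = 0).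
  { apply (RInt_nonneg_eq0 (fun r => d r * d r)); auto.
    - now apply continuous_unit_mult.
    - intros r _; nra.
    - now apply is_RInt_unique. }
  assert (d s = 0) by nra.
  unfold d in *; lra.
Qed.

(** * Hyperbolic inequalities *)

Lemma pow2_lt a b : 0 <= a -> a < b -> a ^ 2 < b ^ 2.
Proof. intros; nra. Qed.

Lemma cosh2_sinh2 x : cosh x ^ 2 = 1 + sinh x ^ 2.
Proof.
  assert (H : exp x * exp (- x) = 1) by (rewrite <- exp_plus, Rplus_opp_r; apply exp_0).
  unfold cosh, sinh; nra.
Qed.

Lemma cosh_minus x y : cosh (x - y) = cosh x * cosh y - sinh x * sinh y.
Proof.
  unfold cosh, sinh.
  replace (- (x - y)) with (- x + y) by ring; unfold Rminus.
  rewrite !exp_plus; field.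
Qed.

Lemma cosh_abs x : cosh (Rabs x) = cosh x.
Proof. unfold Rabs; destruct (Rcase_abs x); [apply cosh_opp|reflexivity]. Qed.

Lemma sinh_abs x : sinh (Rabs x) = Rabs (sinh x).
Proof.
  unfold Rabs at 1; destruct (Rcase_abs x) as [H|H].
  - rewrite sinh_opp, Rabs_left; [reflexivity|].
    generalize (sinh_pos (- x) ltac:(lra)); rewrite sinh_opp; lra.
  - destruct (Req_dec x 0) as [->|].
    + rewrite sinh_0, Rabs_R0; reflexivity.
    + rewrite Rabs_right; [reflexivity|]; generalize (sinh_pos x ltac:(lra)); lra.
Qed.

Lemma cosh_ge1 x : 1 <= cosh x.
Proof.
  generalize (cosh2_sinh2 x) (exp_pos x) (exp_pos (- x)); intros H H1 H2.
  assert (0 < cosh x) by (unfold cosh; lra).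
  nra.
Qed.

Lemma abs_sinh_lt_cosh x : Rabs (sinh x) < cosh x.
Proof.
  rewrite <- sinh_abs, <- cosh_abs; unfold sinh, cosh.
  generalize (exp_pos (- Rabs x)); lra.
Qed.

Lemma cosh_le x y : Rabs x <= y -> cosh x <= cosh y.
Proof.
  intros Hxy; rewrite <- cosh_abs.
  generalize (Rabs_pos x) (cosh_ge1 (Rabs x)) (cosh_ge1 y)
    (cosh2_sinh2 (Rabs x)) (cosh2_sinh2 y); intros H0 H1 H2 H3 H4.
  assert (Hs : 0 <= sinh (Rabs x)) by (rewrite sinh_abs; apply Rabs_pos).
  assert (sinh (Rabs x) <= sinh y).
  { destruct Hxy as [H| ->]; [left; now apply sinh_lt|right; reflexivity]. }
  nra.
Qed.

Lemma abs_le_of_cosh_lt x y : 0 <= y -> cosh x < cosh y -> Rabs x <= y.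
Proof.
  intros Hy Hc; destruct (Rle_or_lt (Rabs x) y) as [|H]; [assumption|exfalso].
  generalize (cosh_le y (Rabs x)); rewrite cosh_abs, (Rabs_right y) by lra; lra.
Qed.

(** Minkowski-type reversed Cauchy inequality:
    [(p cosh x - q sinh x)^2 = p^2 - q^2 + (p sinh x - q cosh x)^2]. *)
Lemma hyperbolic_gt_of_sqr p q k x :
  0 < p -> k ^ 2 + q ^ 2 < p ^ 2 -> k < p * cosh x - q * sinh x.
Proof.
  intros Hp Hk.
  generalize (cosh2_sinh2 x) (cosh_ge1 x); intros Hcs Hc1.
  assert (Hsq : (p * cosh x - q * sinh x) ^ 2
    = p ^ 2 - q ^ 2 + (p * sinh x - q * cosh x) ^ 2).
  { replace ((p * cosh x - q * sinh x) ^ 2) with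
      (p ^ 2 * cosh x ^ 2 - 2 * p * q * cosh x * sinh x + q ^ 2 * sinh x ^ 2) by ring.
    replace ((p * sinh x - q * cosh x) ^ 2) with
      (p ^ 2 * sinh x ^ 2 - 2 * p * q * cosh x * sinh x + q ^ 2 * cosh x ^ 2) by ring.
    rewrite Hcs; ring. }
  generalize (pow2_ge_0 (p * sinh x - q * cosh x)); intros Hge.
  assert (Hpos : 0 < p * cosh x - q * sinh x).
  { assert (Hq : Rabs q < p) by (apply Rabs_def1; nra).
    generalize (Rle_abs (q * sinh x)) (abs_sinh_lt_cosh x) (Rabs_pos (sinh x))
      (Rabs_pos q); rewrite Rabs_mult; nra. }
  nra.
Qed.

(** The minimiser has [sinh x = q / w] and [cosh x = p / w], where
    [w = sqrt (p ^ 2 - q ^ 2)]; the value of [cosh x] serves to locate [x]. *)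
Lemma hyperbolic_min_attained p q :
  Rabs q < p ->
  exists x, cosh x * sqrt (p ^ 2 - q ^ 2) = p /\
    p * cosh x - q * sinh x = sqrt (p ^ 2 - q ^ 2).
Proof.
  intros Hq; apply Rabs_def2 in Hq.
  assert (Hw2 : 0 < p ^ 2 - q ^ 2) by nra.
  set (w := sqrt (p ^ 2 - q ^ 2)).
  assert (Hw : 0 < w) by now apply sqrt_lt_R0.
  assert (Hww : w ^ 2 = p ^ 2 - q ^ 2) by (apply pow2_sqrt; lra).
  exists (arcsinh (q / w)).
  assert (Hs := sinh_arcsinh (q / w)).
  assert (Hc := cosh2_sinh2 (arcsinh (q / w))).
  assert (Hc1 := cosh_ge1 (arcsinh (q / w))).
  rewrite Hs in Hc |- *.
  set (c := cosh (arcsinh (q / w))) in *.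
  assert (Hcw : c * w = p).
  { assert (H : (c * w) ^ 2 = p ^ 2).
    { rewrite Rpow_mult_distr, Hc.
      replace ((1 + (q / w) ^ 2) * w ^ 2) with (w ^ 2 + q ^ 2) by (field; lra). lra. }
    assert (0 < c * w) by nra.
    nra. }
  split; [exact Hcw|].
  apply (Rmult_eq_reg_r w); [|lra].
  replace ((p * c - q * (q / w)) * w) with (p * (c * w) - q ^ 2) by (field; lra).
  rewrite Hcw; lra.
Qed.

Lemma abs_lt_sqrt_iff x y : Rabs x < sqrt y <-> x ^ 2 < y.
Proof.
  rewrite <- (sqrt_Rsqr_abs x).
  replace (x ^ 2) with (Rsqr x) by (unfold Rsqr; ring).
  split; intros H.
  - now apply sqrt_lt_0_alt.
  - apply sqrt_lt_1_alt; split; [apply Rle_0_sqr|exact H].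
Qed.

(** The minimum over [s] is on the diagonal, which leaves a condition in the
    single variable [x = m * (t - 1 / 2)]. *)
Lemma green_pos_iff m delta1 delta2 :
  0 < m -> delta2 < - m ^ 2 ->
  ((forall t s, unit_interval t -> unit_interval s -> 0 < green m delta1 delta2 t s)
   <-> forall x, Rabs x <= m / 2 ->
       (- delta2 - m ^ 2) * cosh (m / 2) < - delta2 * cosh x - delta1 * m * sinh x).
Proof.
  intros Hm Hd.
  assert (HS := sinh_pos (m / 2) ltac:(lra)).
  assert (HmS : 0 < 2 * m * sinh (m / 2)) by nra.
  assert (Hgreen : forall t s, green m delta1 delta2 t s =
    (- delta2 * cosh (m * (t - 1 / 2)) - delta1 * m * sinh (m * (t - 1 / 2))
     - (- delta2 - m ^ 2) * cosh (m * (1 / 2 - Rabs (t - s))))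
    / ((- delta2 - m ^ 2) * (2 * m * sinh (m / 2)))).
  { intros t s; unfold green; field; repeat split; lra. }
  assert (HDmS : 0 < (- delta2 - m ^ 2) * (2 * m * sinh (m / 2)))
    by (apply Rmult_lt_0_compat; lra).
  split.
  - intros Hpos x Hx; apply Rabs_le_between in Hx.
    assert (Ht : unit_interval (x / m + 1 / 2)).
    { unfold unit_interval; split; apply (Rmult_le_reg_r m); try lra;
        replace ((x / m + 1 / 2) * m) with (x + m / 2) by (field; lra); lra. }
    generalize (Hpos _ _ Ht Ht); rewrite Hgreen.
    replace (m * (x / m + 1 / 2 - 1 / 2)) with x by (field; lra).
    rewrite Rminus_diag, Rabs_R0.
    replace (m * (1 / 2 - 0)) with (m / 2) by field.
    intros H; apply Rmult_lt_compat_r with (1 := HDmS) in H.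
    rewrite Rmult_0_l in H.
    match type of H with 0 < ?a / ?b * ?b =>
      replace (a / b * b) with a in H by (field; repeat split; lra) end.
    lra.
  - intros H t s Ht Hs; rewrite Hgreen; apply Rdiv_lt_0_compat; [|exact HDmS].
    unfold unit_interval in *.
    assert (Hx : Rabs (m * (t - 1 / 2)) <= m / 2) by (apply Rabs_le; nra).
    assert (Hr : Rabs (m * (1 / 2 - Rabs (t - s))) <= m / 2).
    { assert (0 <= Rabs (t - s) <= 1) by (split; [apply Rabs_pos|apply Rabs_le; lra]).
      apply Rabs_le; nra. }
    generalize (H _ Hx) (cosh_le _ _ Hr); nra.
Qed.

(** The condition at [x = h] and [x = - h], where the terms in [p] cancel. *)
Lemma hyperbolic_endpoint_bound m p q h :
  0 <= h ->
  (forall x, Rabs x <= h -> (p - m ^ 2) * cosh h < p * cosh x - q * sinh x) ->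
  Rabs q * sinh h < m ^ 2 * cosh h.
Proof.
  intros Hh H.
  generalize (H h ltac:(rewrite Rabs_right; lra))
    (H (- h) ltac:(rewrite Rabs_Ropp, Rabs_right; lra)).
  rewrite cosh_opp, sinh_opp; intros H1 H2.
  unfold Rabs; destruct (Rcase_abs q); lra.
Qed.

(** For [p] at least [m^2 coth^2 h], the endpoint bound
    [|q| < m^2 coth h] gives [|q| / p < tanh h], so the minimum over the whole
    line is attained within [[-h, h]] and decides the question. *)
Lemma hyperbolic_interior_iff m p q h :
  0 < h -> m ^ 2 < p -> m ^ 2 * cosh h ^ 2 <= p * sinh h ^ 2 ->
  ((forall x, Rabs x <= h -> (p - m ^ 2) * cosh h < p * cosh x - q * sinh x)
   <-> q ^ 2 < p ^ 2 - (p - m ^ 2) ^ 2 * cosh h ^ 2).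
Proof.
  intros Hh Hp Hk.
  assert (HS := sinh_pos h Hh).
  assert (HC := cosh_ge1 h).
  assert (HCS := cosh2_sinh2 h).
  assert (HSC : sinh h < cosh h) by nra.
  generalize (pow2_ge_0 m); intros Hm2.
  split.
  - intros H.
    assert (He := hyperbolic_endpoint_bound m p q h ltac:(lra) H).
    (* [|q| / p < tanh h]: the critical point is inside the interval. *)
    assert (Hqp : Rabs q * cosh h < p * sinh h).
    { apply (Rmult_lt_reg_r (sinh h)); [exact HS|]. nra. }
    assert (Hq : Rabs q < p) by (generalize (Rabs_pos q); nra).
    destruct (hyperbolic_min_attained p q Hq) as (x & Hx & Hmin).
    assert (Hq2 : q ^ 2 < p ^ 2).
    { rewrite <- (pow2_abs q); apply pow2_lt; [apply Rabs_pos|exact Hq]. }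
    set (w := sqrt (p ^ 2 - q ^ 2)) in *.
    assert (Hw : 0 < w) by (apply sqrt_lt_R0; lra).
    assert (Hww : w ^ 2 = p ^ 2 - q ^ 2) by (apply pow2_sqrt; lra).
    (* This says [cosh x < cosh h] at the critical point. *)
    assert (HwC : p < w * cosh h).
    { assert (p ^ 2 < (w * cosh h) ^ 2).
      { rewrite Rpow_mult_distr, Hww, <- (pow2_abs q).
        assert (Hsq : (Rabs q * cosh h) ^ 2 < (p * sinh h) ^ 2).
        { apply pow2_lt; [|exact Hqp].
          apply Rmult_le_pos; [apply Rabs_pos|lra]. }
        rewrite !Rpow_mult_distr, HCS in Hsq; rewrite HCS; lra. }
      assert (0 < w * cosh h) by nra.
      nra. }
    assert (Hxh : Rabs x <= h).
    { apply abs_le_of_cosh_lt; [lra|].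
      apply (Rmult_lt_reg_r w); lra. }
    generalize (H x Hxh); rewrite Hmin; intros HD.
    assert (0 < (p - m ^ 2) * cosh h) by (apply Rmult_lt_0_compat; lra).
    assert (Hsq : ((p - m ^ 2) * cosh h) ^ 2 < w ^ 2) by (apply pow2_lt; lra).
    rewrite <- Rpow_mult_distr; lra.
  - intros Hq x _; apply hyperbolic_gt_of_sqr; [lra|].
    rewrite Rpow_mult_distr; lra.
Qed.

(** The gap [p cosh x - |q| |sinh x| - (p - m^2) cosh h] is nonincreasing in
    [p] and in [|q|].  At the extreme values [p = m^2 coth^2 h] and
    [|q| = m^2 coth h] it is the positive multiple
    [m^2 (cosh h / sinh^2 h) (cosh (h - |x|) - 1)] of a nonnegative quantity.
    Strictness comes from [|q|], except at [x = 0], where it is the last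
    hypothesis. *)
Lemma hyperbolic_endpoint_iff m p q h :
  0 < h -> 0 < m -> p * sinh h ^ 2 < m ^ 2 * cosh h ^ 2 ->
  (p - m ^ 2) * cosh h < p ->
  ((forall x, Rabs x <= h -> (p - m ^ 2) * cosh h < p * cosh x - q * sinh x)
   <-> Rabs q * sinh h < m ^ 2 * cosh h).
Proof.
  intros Hh Hm Hk Hg.
  assert (HS := sinh_pos h Hh).
  assert (HC := cosh_ge1 h).
  assert (HCS := cosh2_sinh2 h).
  assert (Hm2 : 0 < m ^ 2) by (apply pow_lt; lra).
  split; [apply hyperbolic_endpoint_bound; lra|].
  intros Hq x Hx.
  assert (Hcx := cosh_le x h Hx).
  assert (Hd := cosh_ge1 (h - Rabs x)).
  rewrite cosh_minus, cosh_abs, sinh_abs in Hd.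
  assert (Hqs : q * sinh x <= Rabs q * Rabs (sinh x))
    by (rewrite <- Rabs_mult; apply Rle_abs).
  destruct (Req_dec (sinh x) 0) as [H0|H0].
  - generalize (cosh2_sinh2 x) (cosh_ge1 x); rewrite H0; intros H1 H2.
    assert (cosh x = 1) by nra.
    nra.
  - assert (Ha : 0 < Rabs (sinh x)) by now apply Rabs_pos_lt.
    set (a := Rabs (sinh x)) in *; set (c := cosh x) in *.
    set (S := sinh h) in *; set (C := cosh h) in *.
    assert (E1 : Rabs q * a * S ^ 2 < m ^ 2 * C * a * S).
    { replace (Rabs q * a * S ^ 2) with (Rabs q * S * (a * S)) by ring.
      replace (m ^ 2 * C * a * S) with (m ^ 2 * C * (a * S)) by ring.
      apply Rmult_lt_compat_r; [now apply Rmult_lt_0_compat|exact Hq]. }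
    assert (E2 : 0 <= (m ^ 2 * C ^ 2 - p * S ^ 2) * (C - c))
      by (apply Rmult_le_pos; lra).
    assert (E3 : 0 <= m ^ 2 * C * (C * c - S * a - 1))
      by (apply Rmult_le_pos; [apply Rmult_le_pos|]; lra).
    assert (E4 : 0 < (p * c - Rabs q * a - (p - m ^ 2) * C) * S ^ 2).
    { replace ((p * c - Rabs q * a - (p - m ^ 2) * C) * S ^ 2) with
        (m ^ 2 * C * (C * c - S * a - (C ^ 2 - S ^ 2))
         + (m ^ 2 * C ^ 2 - p * S ^ 2) * (C - c)
         + (m ^ 2 * C * a * S - Rabs q * a * S ^ 2)) by ring.
      replace (C ^ 2 - S ^ 2) with 1 by lra. lra. }
    assert (0 < p * c - Rabs q * a - (p - m ^ 2) * C).
    { apply (Rmult_lt_reg_r (S ^ 2)); [apply pow_lt; exact HS|lra]. }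
    lra.
Qed.

Theorem theorem5p7 (m delta1 delta2 : R) (G : R -> R -> R) :
  let M := - m ^ 2 in
  let gM := - (m ^ 2 * cosh (m / 2) / (cosh (m / 2) - 1)) in
  let kM := - (m ^ 2 * (coth (m / 2)) ^ 2) in
  0 < m ->
  gM < delta2 < M ->
  is_green_function M delta1 delta2 G ->
  (gM < delta2 <= kM ->
     (strictly_positive G <->
      Rabs delta1 <
        sqrt (delta2 ^ 2 - (m ^ 2 + delta2) ^ 2 * (cosh (m / 2)) ^ 2) / m)) /\
  (kM < delta2 < M ->
     (strictly_positive G <-> Rabs delta1 < m * coth (m / 2))).
Proof.
  intros M gM kM Hm [Hg HdM] HG.
  assert (HS := sinh_pos (m / 2) ltac:(lra)).
  assert (HCS := cosh2_sinh2 (m / 2)).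
  assert (HC := cosh_ge1 (m / 2)).
  assert (HC1 : 1 < cosh (m / 2)) by nra.
  assert (HmS : 0 < sinh (m / 2) ^ 2) by (apply pow_lt; lra).
  unfold M in HdM.
  assert (Hmul : Rabs (delta1 * m) = Rabs delta1 * m)
    by (rewrite Rabs_mult, (Rabs_right m); lra).
  assert (Hk : - kM * sinh (m / 2) ^ 2 = m ^ 2 * cosh (m / 2) ^ 2)
    by (unfold kM, coth; field; lra).
  assert (Hpos : strictly_positive G <->
    forall x, Rabs x <= m / 2 ->
      (- delta2 - m ^ 2) * cosh (m / 2)
        < - delta2 * cosh x - delta1 * m * sinh x).
  { rewrite <- green_pos_iff by assumption; unfold strictly_positive.
    split; intros H t s Ht Hs; generalize (H t s Ht Hs);
      rewrite (green_unique m delta1 delta2 G) by (assumption || lra); auto. }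
  split.
  - intros [_ Hle].
    rewrite Hpos, hyperbolic_interior_iff, <- abs_lt_sqrt_iff, Hmul by nra.
    replace ((- delta2) ^ 2) with (delta2 ^ 2) by ring.
    replace ((- delta2 - m ^ 2) ^ 2) with ((m ^ 2 + delta2) ^ 2) by ring.
    set (w := sqrt _).
    replace w with (w / m * m) at 1 by (field; lra).
    split; intros H; [apply (Rmult_lt_reg_r m)|apply Rmult_lt_compat_r]; assumption.
  - intros [Hlt _].
    assert (HgM : - gM * (cosh (m / 2) - 1) = m ^ 2 * cosh (m / 2))
      by (unfold gM; field; lra).
    rewrite Hpos, hyperbolic_endpoint_iff, Hmul by nra.
    replace (Rabs delta1 * m * sinh (m / 2))
      with (Rabs delta1 * (m * sinh (m / 2))) by ring.
    replace (m ^ 2 * cosh (m / 2)) with (m * coth (m / 2) * (m * sinh (m / 2)))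
      by (unfold coth; field; lra).
    assert (Hms : 0 < m * sinh (m / 2)) by (apply Rmult_lt_0_compat; lra).
    split; intros H; [apply (Rmult_lt_reg_r (m * sinh (m / 2)))|apply Rmult_lt_compat_r];
      assumption.
Qed.
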